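(* Let $\mathbf{A}$ be a finite lattice algebra, let $\tau$ be a finite relational vocabulary, and for each $R\in\tau$ let $p_R\colon A\to[0,1]$ be a probability distribution with $p_R(a)>0$ for every $a\in A$. Then for every sentence $\varphi$ of $\mathcal{L}^{\mathbf{A}}(\tau)$ and every $a\in A$, either $\lim_{n\to\infty}\mu_n(\varphi=a)=1$ or $\lim_{n\to\infty}\mu_n(\varphi=a)=0$. Equivalently, for every sentence $\varphi$ of $\mathcal{L}^{\mathbf{A}}(\tau)$ there is a unique $a\in A$ such that $\lim_{n\to\infty}\mu_n(\varphi=a)=1$.
   Context: A lattice algebra is an algebra $\mathbf{A}=\langle A,\wedge,\vee,\dots\rangle$ with a lattice reduct $\langle A,\wedge,\vee\rangle$ and possibly further finitary operations. For a relational vocabulary $\tau$ (each $R\in\tau$ has an arity $\tau(R)$), the formulas of $\mathcal{L}^{\mathbf{A}}(\tau)$ are built from atomic formulas $R(x_1,\dots,x_{\tau(R)})$ using one connective for each operation of $\mathbf{A}$ and the quantifiers $\forall,\exists$. An $\mathbf{A}$-valued $\tau$-structure $\mathfrak{M}$ has a nonempty domain $M$ and maps $R^{\mathfrak{M}}\colon M^{\tau(R)}\to A$; the value $\|\varphi\|^{\mathfrak{M}}(m_1,\dots,m_k)\in A$ is defined inductively, interpreting atomic formulas by $\mathfrak{M}$, connectives by the operations of $\mathbf{A}$, $\forall$ as infimum and $\exists$ as supremum in the lattice. Let $\mathrm{Mod}^{\mathbf{A}}_{\tau,n}$ be the (finite) set of $\mathbf{A}$-valued $\tau$-structures with domain $[n]=\{1,\dots,n\}$,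 and define $\Pr_n(\mathfrak{M})=\prod\{p_R(R^{\mathfrak{M}}(i_1,\dots,i_{\tau(R)})) : R\in\tau,\ i_1,\dots,i_{\tau(R)}\in[n]\}$. For a sentence $\varphi$ and $a\in A$, $\mu_n(\varphi=a)=\sum\{\Pr_n(\mathfrak{M}) : \mathfrak{M}\in\mathrm{Mod}^{\mathbf{A}}_{\tau,n},\ \|\varphi\|^{\mathfrak{M}}=a\}$.
   Formalization: Every relation symbol of τ is required to have arity at least 1; with a nullary symbol S and |A| ≥ 2 the claim fails, since μ_n(S = a) = p_S(a) lies strictly between 0 and 1 for every n. *)

(* Defs.v *)
From HB Require Import structures.
From mathcomp Require Import all_boot all_order all_algebra.
From mathcomp Require Import boolp classical_sets reals topology normedtype.

Set Implicit Arguments.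
Unset Strict Implicit.
Unset Printing Implicit Defensive.

Import Order.TTheory GRing.Theory Num.Theory.
Import numFieldNormedType.Exports.

Local Open Scope ring_scope.

(* A finTBLatticeType is an arbitrary nonempty finite lattice; its top and
   bottom are not connectives unless some la_op denotes them. *)
Record finLatticeAlgebra (d : Order.disp_t) := FinLatticeAlgebra {
  la_lattice :> finTBLatticeType d;
  la_op : Type;
  la_arity : la_op -> nat;
  la_fun : forall o : la_op, (la_arity o).-tuple la_lattice -> la_lattice
}.

(* Relation symbols have positive arity: a nullary symbol S would satisfy
   mu_n(S = a) = p_S(a) for all n, and there would be no zero-one law. *)
Record finVocabulary := FinVocabulary {
  voc_rel :> finType;
  voc_arity : voc_rel -> nat;
  voc_arity_gt0 : forall S : voc_rel, (0 < voc_arity S)%N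
}.

Section Logic.
Variables (d : Order.disp_t) (A : finLatticeAlgebra d) (tau : finVocabulary).

(* formula k: formulas with free variables among k de Bruijn variables;
   a quantifier binds variable 0 of its body. *)
Inductive formula : nat -> Type :=
| Atom k (S : tau) (x : (voc_arity S).-tuple 'I_k) : formula k
| And k (f g : formula k) : formula k
| Or k (f g : formula k) : formula k
| Op k (o : la_op A) (f : 'I_(la_arity o) -> formula k) : formula k
| Forall k (f : formula k.+1) : formula k
| Exists k (f : formula k.+1) : formula k.

Definition sentence := formula 0.

Definition structure (D : finType) :=
  {dffun forall S : tau, {ffun (voc_arity S).-tuple D -> A}}.

(* The infimum and supremum over a nonempty D are iterated meets and joins. *)
Fixpoint value (D : finType) (M : structure D) (k : nat) (f : formula k) :
    k.-tuple D -> A :=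
  match f in formula k return k.-tuple D -> A with
  | Atom _ r x => fun m => M r [tuple of map (tnth m) x]
  | And _ f g => fun m => (value M f m `&` value M g m)%O
  | Or _ f g => fun m => (value M f m `|` value M g m)%O
  | Op _ o f => fun m => la_fun [tuple value M (f i) m | i < la_arity o]
  | Forall _ f => fun m => (\meet_(b : D) value M f [tuple of b :: m])%O
  | Exists _ f => fun m => (\join_(b : D) value M f [tuple of b :: m])%O
  end.

Section Probability.
Variables (R : realType) (p : tau -> A -> R).

Definition is_distribution (q : A -> R) :=
  (forall a, 0 <= q a <= 1) /\ \sum_(a : A) q a = 1.

Definition prob (n : nat) (M : structure 'I_n) : R :=
  \prod_(S : tau) \prod_(i : (voc_arity S).-tuple 'I_n) p S (M S i).

Definition mu (n : nat) (phi : sentence) (a : A) : R :=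
  \sum_(M : structure 'I_n | value M phi [tuple] == a) prob M.

End Probability.
End Logic.

(* Main.v *)
Require Import Defs.
From HB Require Import structures.
From mathcomp Require Import all_boot all_order all_algebra.
From mathcomp Require Import boolp classical_sets reals topology normedtype.
From mathcomp Require Import sequences ring lra.

(* Call a structure K-saturated if every extension of the atomic diagram of
   fewer than K distinct points by one more point is realized. A back-and-forth
   argument shows that two K-saturated structures give the same value to every
   sentence of quantifier rank at most K. In a random structure on n points,
   the points outside a j-tuple realize a given extension independently, each
   with probability at least some q > 0, so a given extension is missed with
   probability at most (1 - q)^(n - j). There are O(n^j) extensions to realize,
   hence the structure is K-saturated with probability tending to 1, and the
   value common to all saturated structures is almost sure. *)

Set Implicit Arguments.
Unset Strict Implicit.
Unset Printing Implicit Defensive.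

Import Order.TTheory GRing.Theory Num.Theory.
Import numFieldNormedType.Exports.

Local Open Scope classical_set_scope.
Local Open Scope ring_scope.

(** * Back-and-forth between saturated structures *)

Section BackAndForth.
Variables (d : Order.disp_t) (A : finLatticeAlgebra d) (tau : finVocabulary).

Fixpoint qrank k (f : formula A tau k) : nat :=
  match f with
  | Atom _ _ _ => 0
  | And _ f g => maxn (qrank f) (qrank g)
  | Or _ f g => maxn (qrank f) (qrank g)
  | Op _ _ f => \max_i qrank (f i)
  | Forall _ f => (qrank f).+1
  | Exists _ f => (qrank f).+1
  end.

Definition pullback (D E : finType) (M : structure A tau D) (h : E -> D) :
    structure A tau E :=
  [ffun S : tau => [ffun x : (voc_arity S).-tuple E => M S [tuple of map h x]]].

Lemma pullbackE (D E : finType) (M : structure A tau D) (h : E -> D) S x :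
  pullback M h S x = M S [tuple of map h x].
Proof. by rewrite !ffunE. Qed.

Lemma structureP (D : finType) (M N : structure A tau D) :
  (forall S x, M S x = N S x) -> M = N.
Proof. by move=> MN; apply/ffunP => S; apply/ffunP => x. Qed.

Lemma eq_pullback (D E : finType) (M : structure A tau D) (g h : E -> D) :
  g =1 h -> pullback M g = pullback M h.
Proof.
move=> gh; apply: structureP => S x; rewrite !pullbackE; congr (M S _).
by apply: val_inj; apply: eq_map.
Qed.

Lemma pullback_comp (D E F : finType) (M : structure A tau D)
    (h : E -> D) (g : F -> E) :
  pullback (pullback M h) g = pullback M (h \o g).
Proof.
apply: structureP => S x; rewrite !pullbackE; congr (M S _).
by apply: val_inj; rewrite /= map_comp.
Qed.

(** [T] is the diagram of [j.+1] points: index 0 stands for the new point, and [lift ord0] embeds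
    the indices of [c]. *)
Definition extension_realized (D : finType) (M : structure A tau D) j
    (c : j.-tuple D) (T : structure A tau 'I_j.+1) : bool :=
  [exists b, (b \notin c) && (pullback M (tnth [tuple of b :: c]) == T)].

Definition extension_axiom (D : finType) (M : structure A tau D) j
    (c : j.-tuple D) (T : structure A tau 'I_j.+1) : bool :=
  uniq c ==> (pullback T (lift ord0) == pullback M (tnth c)) ==>
  extension_realized M c T.

Definition saturated K (D : finType) (M : structure A tau D) : bool :=
  [forall j : 'I_K, forall c : j.-tuple D, forall T, extension_axiom M c T].

Lemma tnth_cons_lift (D : Type) j (b : D) (c : j.-tuple D) i :
  tnth [tuple of b :: c] (lift ord0 i) = tnth c i.
Proof. by rewrite (tnth_nth b) [RHS](tnth_nth b). Qed.

Lemma saturatedP K (D : finType) (M : structure A tau D) j (c : j.-tuple D)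
    (T : structure A tau 'I_j.+1) :
  saturated K M -> (j < K)%N -> uniq c ->
  pullback T (lift ord0) = pullback M (tnth c) ->
  exists2 b, b \notin c & pullback M (tnth [tuple of b :: c]) = T.
Proof.
move=> satM jK uc e; move/forallP: satM => /(_ (Ordinal jK)) /forallP /(_ c).
move=> /forallP /(_ T) /implyP /(_ uc) /implyP; rewrite e => /(_ (eqxx _)).
by move=> /existsP[b /andP[bc /eqP e']]; exists b.
Qed.

Definition env (D : Type) j k (c : j.-tuple D) (s : 'I_k -> 'I_j) : k.-tuple D
  :=
  [tuple tnth c (s i) | i < k].

Definition env_cons j k (i0 : 'I_j) (s : 'I_k -> 'I_j) (i : 'I_k.+1) : 'I_j :=
  oapp s i0 (unlift ord0 i).

Lemma env_consE (D : Type) j k (c : j.-tuple D) i0 (s : 'I_k -> 'I_j) :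
  env c (env_cons i0 s) = [tuple of tnth c i0 :: env c s].
Proof.
apply: eq_from_tnth => i; rewrite tnth_mktuple /env_cons.
case: unliftP => [i' ->|->] /=; last by rewrite tnth0.
by rewrite tnth_cons_lift tnth_mktuple.
Qed.

Lemma env_weaken (D : Type) j k (b : D) (c : j.-tuple D) (s : 'I_k -> 'I_j) :
  env [tuple of b :: c] (fun i => lift ord0 (s i)) = env c s.
Proof.
by apply: eq_from_tnth => i; rewrite !tnth_mktuple tnth_cons_lift.
Qed.

Lemma le_meets_matching (D E : finType) (F : D -> A) (G : E -> A) :
  (forall b, exists b', G b' = F b) ->
  (\meet_(b' : E) G b' <= \meet_(b : D) F b)%O.
Proof.
move=> FG; apply/meetsP => b _; have [b' <-] := FG b.
exact: Order.TMeetTheory.meets_inf.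
Qed.

Lemma le_joins_matching (D E : finType) (F : D -> A) (G : E -> A) :
  (forall b, exists b', G b' = F b) ->
  (\join_(b : D) F b <= \join_(b' : E) G b')%O.
Proof.
move=> FG; apply/joinsP => b _; have [b' <-] := FG b.
exact: Order.BJoinTheory.joins_sup.
Qed.

(* Formulas have no equality, so the tuples of a back-and-forth game may have
   repetitions; they are written [env c s] with [c] duplicate-free, since
   extension axioms only hold over distinct points. *)
Definition back_and_forth K k (f : formula A tau k) :=
  forall (D E : finType) (M : structure A tau D) (N : structure A tau E),
  saturated K M -> saturated K N ->
  forall j (c : j.-tuple D) (c' : j.-tuple E) (s : 'I_k -> 'I_j),
  uniq c -> uniq c' -> pullback M (tnth c) = pullback N (tnth c') ->
  (qrank f + j <= K)%N -> value M f (env c s) = value N f (env c' s).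

(** If [b] occurs in [c], the answer is the entry of [c'] at the same index. Otherwise the diagram
    of [b :: c] extends that of [c'], and saturation of [N] realizes it. *)
Lemma forth K k (f : formula A tau k.+1) : back_and_forth K f ->
  forall (D E : finType) (M : structure A tau D) (N : structure A tau E),
  saturated K M -> saturated K N ->
  forall j (c : j.-tuple D) (c' : j.-tuple E) (s : 'I_k -> 'I_j),
  uniq c -> uniq c' -> pullback M (tnth c) = pullback N (tnth c') ->
  ((qrank f).+1 + j <= K)%N -> forall b, exists b',
  value N f [tuple of b' :: env c' s] = value M f [tuple of b :: env c s].
Proof.
move=> bf D E M N satM satN j c c' s uc uc' e le b.
have [bc|bc] := boolP (b \in c).
  have /tnthP[i ->] := bc; exists (tnth c' i).
  rewrite -!env_consE; apply/esym/bf => //.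
  by apply: leq_trans le; rewrite leq_add2r.
have jK : (j < K)%N by apply: leq_trans le; rewrite addSn ltnS leq_addl.
have [|b' bc' e'] :=
  @saturatedP K E N j c' (pullback M (tnth [tuple of b :: c])) satN jK uc'.
  by rewrite pullback_comp -e; apply: eq_pullback => i; exact: tnth_cons_lift.
exists b'; rewrite -(env_weaken b) -(env_weaken b').
(* De Bruijn variable 0 now points at index 0 of the longer tuple, so the induction hypothesis
   applies to [b :: c] and [b' :: c']. The rank lost with the quantifier pays for the extra
   point. *)
have -> : [tuple of b :: env [tuple of b :: c] (fun i => lift ord0 (s i))] =
  env [tuple of b :: c] (env_cons ord0 (fun i => lift ord0 (s i))).
  by rewrite env_consE tnth0.
have -> : [tuple of b' :: env [tuple of b' :: c'] (fun i => lift ord0 (s i))] =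
  env [tuple of b' :: c'] (env_cons ord0 (fun i => lift ord0 (s i))).
  by rewrite env_consE tnth0.
by apply/esym/bf => //=; rewrite ?bc ?bc' // addnS -addSn.
Qed.

Lemma saturated_back_and_forth K k (f : formula A tau k) : back_and_forth K f.
Proof.
elim: f => {k} [k S x|k f IHf g IHg|k f IHf g IHg|k o f IH|k f IH|k f IH]
  D E M N satM satN j c c' s uc uc' e /= le.
- have := congr1 (fun T : structure A tau 'I_j => T S [tuple of map s x]) e;
    rewrite !pullbackE.
  congr (_ = _); [congr (M S _)|congr (N S _)];
    apply: val_inj; rewrite /= -map_comp; apply: eq_map => i;
    by rewrite tnth_mktuple.
- rewrite (IHf _ _ M N _ _ j c c') ?(IHg _ _ M N _ _ j c c') //;
    by apply: leq_trans le; rewrite leq_add2r ?leq_maxl ?leq_maxr.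
- rewrite (IHf _ _ M N _ _ j c c') ?(IHg _ _ M N _ _ j c c') //;
    by apply: leq_trans le; rewrite leq_add2r ?leq_maxl ?leq_maxr.
- congr la_fun; apply: eq_mktuple => i; apply: IH => //.
  apply: leq_trans le; rewrite leq_add2r.
  exact: (@leq_bigmax _ (fun i => qrank (f i))).
- by apply/le_anti/andP; split; apply: le_meets_matching; apply: (forth IH).
- by apply/le_anti/andP; split; apply: le_joins_matching; apply: (forth IH).
Qed.

Lemma saturated_value_sentence (phi : sentence A tau) (D E : finType)
    (M : structure A tau D) (N : structure A tau E) :
  saturated (qrank phi) M -> saturated (qrank phi) N ->
  value M phi [tuple] = value N phi [tuple].
Proof.
move=> satM satN; have := @saturated_back_and_forth _ 0 phi D E M N satM satN.
move=> /(_ 0 [tuple] [tuple] id isT isT).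
rewrite !(tuple0 (env [tuple] id)); apply; last by rewrite addn0.
apply: structureP => S x.
(* Positive arity matters here: [x] would have an entry in the empty type ['I_0], so all diagrams of
   the empty tuple coincide. *)
by case: (tnth x (Ordinal (voc_arity_gt0 S))).
Qed.

End BackAndForth.

(** * Finite product measures and independence *)

Section ProductMeasure.
Variables (R : comNzRingType) (I X : finType) (w : I -> X -> R).
Hypothesis w_sum1 : forall i, \sum_a w i a = 1.

Lemma sum_ffun_prod (h : I -> X -> R) :
  \sum_(F : {ffun I -> X}) (\prod_i w i (F i)) * (\prod_i h i (F i)) =
  \prod_i \sum_a w i a * h i a.
Proof.
by rewrite bigA_distr_bigA; apply: eq_bigr => F _; rewrite -big_split.
Qed.

(** The probability of a cylinder set: coordinates in [U] contribute the weight of their prescribed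
    value, the others sum to 1. *)
Lemma sum_ffun_cylinder (U : pred I) (t : I -> X) :
  \sum_(F : {ffun I -> X})
     (\prod_i w i (F i)) * (\prod_(i | U i) (F i == t i)%:R) =
  \prod_(i | U i) w i (t i).
Proof.
pose h i a : R := if U i then (a == t i)%:R else 1.
rewrite [RHS]big_mkcond -[RHS](_ : \prod_i \sum_a w i a * h i a = _);
  last first.
  apply: eq_bigr => i _; rewrite /h; case: (U i).
    rewrite (bigD1 (t i)) //= eqxx mulr1 big1 ?addr0 // => a /negPf->.
    by rewrite mulr0.
  by rewrite -[RHS](w_sum1 i); apply: eq_bigr => a _; rewrite mulr1.
rewrite -sum_ffun_prod; apply: eq_bigr => F _.
by rewrite [X in _ * X]big_mkcond.
Qed.

(** Each [i] lies in at most one block, so no factor is repeated. This merges a conjunction of block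
    events into a single cylinder. *)
Lemma prod_disjoint_blocks (D : finType) (C : D -> pred I) (J : {set D})
    (G : I -> R) :
  (forall b b' i, C b i -> C b' i -> b = b') ->
  \prod_(b in J) \prod_(i | C b i) G i =
  \prod_(i | [exists b in J, C b i]) G i.
Proof.
move=> disj; rewrite (exchange_big_dep (fun i => [exists b in J, C b i])) /=.
  apply: eq_bigr => i /existsP[b /andP[bJ Cbi]].
  rewrite (big_pred1 b) // => b' /=; apply/andP/eqP => [[_ Cb'i]|->] //.
  exact: disj Cb'i Cbi.
by move=> b i bJ Cbi; apply/existsP; exists b; rewrite bJ.
Qed.

Lemma prod_1B (D : finType) (x : D -> R) :
  \prod_b (1 - x b) = \sum_(J : {set D}) (-1) ^+ #|J| * \prod_(b in J) x b.
Proof.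
under eq_bigr => b _ do rewrite addrC.
rewrite bigA_distr; apply: eq_big => [J|J _]; first by rewrite inE.
by rewrite -prodrN [RHS]big_mkcond.
Qed.

(* Independence of the events "F agrees with t on C b", read off the
   inclusion-exclusion expansion of both sides. *)
Lemma sum_ffun_disjoint_blocks (D : finType) (C : D -> pred I) (t : I -> X) :
  (forall b b' i, C b i -> C b' i -> b = b') ->
  \sum_(F : {ffun I -> X}) (\prod_i w i (F i)) *
     (\prod_b (1 - \prod_(i | C b i) (F i == t i)%:R)) =
  \prod_b (1 - \prod_(i | C b i) w i (t i)).
Proof.
move=> disj; rewrite prod_1B.
under eq_bigr => F _ do rewrite prod_1B mulr_sumr.
rewrite exchange_big; apply: eq_bigr => J _ /=.
rewrite prod_disjoint_blocks // -sum_ffun_cylinder mulr_sumr.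
by apply: eq_bigr => F _; rewrite prod_disjoint_blocks // mulrCA.
Qed.

End ProductMeasure.

(** * Geometric decay beats polynomial growth *)

Section GeometricDecay.
Variable R : realType.

Lemma natr_mul_expr_bounded (s : R) : 0 <= s < 1 ->
  exists C, forall n, n%:R * s ^+ n <= C.
Proof.
move=> /andP[s0 s1]; have s10 : 0 < 1 - s by rewrite subr_gt0.
exists (1 - s)^-1 => n; rewrite -[leRHS]mul1r ler_pdivlMr //.
have sn0 m : 0 <= s ^+ m by rewrite exprn_ge0.
(* The sharper bound [1 - s ^+ n] is what the induction carries: it is [1 - s] times a geometric sum
   of [n] terms, each at least [s ^+ n]. *)
apply: (@le_trans _ _ (1 - s ^+ n)); last by rewrite gerBl.
elim: n => [|n IH]; first by rewrite mul0r mul0r expr0 subrr.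
have u1 : s ^+ n.+1 <= 1 by rewrite exprn_ile1 // ltW.
have h1 := ler_wpM2l s0 IH; have h2 := ler_wpM2r (ltW s10) u1.
move: h1 h2; rewrite exprS -natr1; nra.
Qed.

Lemma polynomial_mul_expr_bounded j (r : R) : 0 <= r < 1 ->
  exists C, forall n, n%:R ^+ j * r ^+ n <= C.
Proof.
elim: j r => [|j IH] r /andP[r0 r1].
  by exists 1 => n; rewrite mul1r exprn_ile1 // ltW.
(* The midpoint satisfies [r < s < 1] and is positive even for [r = 0]. Writing [r] as [r / s * s]
   lets the powers of [s] absorb one factor [n]. *)
pose s := (1 + r) / 2.
have s_gt0 : 0 < s by rewrite /s; lra.
have s01 : 0 <= s < 1 by rewrite /s; apply/andP; split; lra.
have rs01 : 0 <= r / s < 1.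
  by rewrite divr_ge0 ?(ltW s_gt0) //= ltr_pdivrMr // mul1r /s; lra.
have [C1 hC1] := IH _ rs01; have [C2 hC2] := natr_mul_expr_bounded s01.
exists (C1 * C2) => n.
have -> : n%:R ^+ j.+1 * r ^+ n =
    n%:R ^+ j * (r / s) ^+ n * (n%:R * s ^+ n) :> R.
  by rewrite -{1}(divfK (lt0r_neq0 s_gt0) r) exprMn exprSr; ring.
have [rs0 _] := andP rs01.
by apply: ler_pM; rewrite ?mulr_ge0 ?exprn_ge0 ?(ltW s_gt0).
Qed.

(** Boundedness for the exponents [j] and [j.+1] bounds [n.+1] times the sequence by [C1 + C2],
    which gives decay like the harmonic sequence. *)
Lemma cvg_polynomial_mul_expr j (r : R) : 0 <= r < 1 ->
  (n%:R ^+ j * r ^+ n) @[n --> \oo] --> (0 : R).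
Proof.
move=> r01; have [r0 _] := andP r01.
have [C1 hC1] := polynomial_mul_expr_bounded j r01.
have [C2 hC2] := polynomial_mul_expr_bounded j.+1 r01.
apply: (@squeeze_cvgr _ _ _ _ (fun=> 0) (fun n => (C1 + C2) * harmonic n)).
- apply: nearW => n; rewrite mulr_ge0 ?exprn_ge0 //=.
  rewrite ler_pdivlMr ?ltr0n // -natr1 mulrDr mulr1 addrC lerD //.
  by rewrite mulrAC -exprSr.
- exact: cvg_cst.
- by rewrite -[X in _ --> X](mulr0 (C1 + C2)); apply: cvgMl_tmp;
    exact: cvg_harmonic.
Qed.

Lemma cvg_polynomial_mul_expr_subn j (r : R) : 0 <= r < 1 ->
  (n%:R ^+ j * r ^+ (n - j)) @[n --> \oo] --> (0 : R).
Proof.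
move=> /andP[r0 r1]; pose s := (1 + r) / 2.
have s_gt0 : 0 < s by rewrite /s; lra.
have s_lt1 : s < 1 by rewrite /s; lra.
have rs : r <= s by rewrite /s; lra.
(* The shift by [j] costs a factor [s ^- j]; [r] itself may be 0 and could not be inverted. The
   truncated [n - j] is harmless, since [n <= j + (n - j)] always holds. *)
apply: (@squeeze_cvgr _ _ _ _ (fun=> 0) (fun n => s ^- j * (n%:R ^+ j * s ^+
  n))).
- apply: nearW => n; rewrite mulr_ge0 ?exprn_ge0 //=.
  rewrite mulrCA ler_wpM2l ?exprn_ge0 //.
  rewrite mulrC ler_pdivlMr ?exprn_gt0 //.
  apply: (@le_trans _ _ (s ^+ (n - j) * s ^+ j)).
    by rewrite ler_wpM2r ?exprn_ge0 ?(ltW s_gt0) // lerXn2r ?nnegrE // ltW.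
  by rewrite -exprD ler_wiXn2l ?(ltW s_gt0) ?(ltW s_lt1) // addnC -leq_subLR.
- exact: cvg_cst.
- rewrite -[X in _ --> X](mulr0 (s ^- j)); apply: cvgMl_tmp.
  by apply: cvg_polynomial_mul_expr; rewrite (ltW s_gt0).
Qed.

End GeometricDecay.

(** * The union bound for finite weighted sums *)

Section UnionBound.
Variables (R : numDomainType) (X I : finType) (w : X -> R).
Hypothesis w_ge0 : forall x, 0 <= w x.

Lemma union_bound (P : pred X) (Q : I -> pred X) :
  (forall x, P x -> exists i, Q i x) ->
  \sum_(x | P x) w x <= \sum_i \sum_(x | Q i x) w x.
Proof.
move=> PQ; under [leRHS]eq_bigr => i _ do rewrite big_mkcond.
rewrite exchange_big [leLHS]big_mkcond; apply: ler_sum => x _ /=.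
have w0 i : 0 <= (if Q i x then w x else 0) by case: ifP.
case: ifP => [/PQ[i Qix]|_]; last exact: sumr_ge0.
by rewrite (bigD1 i) //= Qix lerDl sumr_ge0.
Qed.

End UnionBound.

(** * Random structures and failure of the extension axioms *)

Section RandomStructure.
Variables (R : realType) (d : Order.disp_t) (A : finLatticeAlgebra d).
Variables (tau : finVocabulary) (p : tau -> A -> R).
Hypothesis p_distr : forall S : tau, is_distribution (p S).

(** One index type for all atomic facts over [D], so that a random structure becomes a single family
    of independent coordinates. *)
Definition cell (D : finType) : finType :=
  {S : tau & (voc_arity S).-tuple D}.

Definition structure_of_cells (D : finType) (F : {ffun cell D -> A}) :
    structure A tau D :=
  [ffun S : tau => [ffun x : (voc_arity S).-tuple D =>
    F (Tagged (fun S => (voc_arity S).-tuple D) x)]].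

Lemma structure_of_cellsE (D : finType) (F : {ffun cell D -> A}) u :
  structure_of_cells F (tag u) (tagged u) = F u.
Proof. by rewrite !ffunE; case: u. Qed.

Lemma structure_of_cells_bij (D : finType) : bijective (@structure_of_cells D).
Proof.
exists (fun M : structure A tau D => [ffun u : cell D => M (tag u) (tagged u)])
  => [F|M].
  by apply/ffunP => u; rewrite ffunE structure_of_cellsE.
by apply: structureP => S x; rewrite !ffunE.
Qed.

Lemma prob_structure_of_cells n (F : {ffun cell 'I_n -> A}) :
  prob p (structure_of_cells F) = \prod_u p (tag u) (F u).
Proof.
rewrite /prob sig_big_dep; apply: eq_bigr => u _.
by rewrite structure_of_cellsE.
Qed.

Lemma sum_structure n (G : structure A tau 'I_n -> R) :
  \sum_M prob p M * G M =
  \sum_(F : {ffun cell 'I_n -> A})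
     (\prod_u p (tag u) (F u)) * G (structure_of_cells F).
Proof.
rewrite (reindex _ (onW_bij _ (@structure_of_cells_bij _))).
by apply: eq_bigr => F _; rewrite prob_structure_of_cells.
Qed.

Lemma prob_ge0 n (M : structure A tau 'I_n) : 0 <= prob p M.
Proof.
apply: prodr_ge0 => S _; apply: prodr_ge0 => x _.
by have [/(_ (M S x))/andP[]] := p_distr S.
Qed.

Lemma sum_prob n : \sum_(M : structure A tau 'I_n) prob p M = 1.
Proof.
under eq_bigr => M _ do rewrite -[prob p M]mulr1.
rewrite sum_structure; under eq_bigr => F _ do rewrite mulr1.
rewrite -(bigA_distr_bigA (fun (u : cell 'I_n) a => p (tag u) a)) big1 // => u
  _.
by have [] := p_distr (tag u).
Qed.

Section OneExtension.
Variables (D : finType) (j : nat) (c : j.-tuple D) (T : structure A tau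
  'I_j.+1).
Hypothesis c_uniq : uniq c.

(** Every point outside [c] goes to 0, so this one map inverts [tnth [tuple of b :: c]] for all
    candidates [b] at once, and [prescribed] does not depend on [b]. *)
Definition position (z : D) : 'I_j.+1 :=
  if z \in c then inord (index z c).+1 else ord0.

Lemma positionK (b : D) : b \notin c ->
  {in b :: c, cancel position (tnth [tuple of b :: c])}.
Proof.
move=> bc z; rewrite inE /position => /predU1P[->|zc];
  first by rewrite (negPf bc) tnth0.
rewrite zc (tnth_nth b) /= inordK /=; first by rewrite nth_index.
by rewrite ltnS -{2}(size_tuple c) index_mem.
Qed.

Lemma tnthK_position (b : D) : b \notin c ->
  cancel (tnth [tuple of b :: c]) position.
Proof.
move=> bc i; have uc : uniq [tuple of b :: c] by rewrite /= bc.
have /(positionK bc) : tnth [tuple of b :: c] i \in b :: c by exact: mem_tnth.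
by move/(tuple_uniqP _ uc).
Qed.

(* The cells whose values are prescribed by requiring that [b] realizes an
   extension of [c], beyond those already fixed by [c]. *)
Definition new_cells (b : {b : D | b \notin c}) (u : cell D) : bool :=
  (val b \in (tagged u : seq D)) &&
  all [in val b :: c] (tagged u : seq D).

Definition prescribed (u : cell D) : A :=
  T (tag u) [tuple of map position (tagged u)].

(** A new cell for [b] mentions [b]; being new for [b'] too, its entries lie in [b' :: c], while [b]
    is outside [c]. Disjointness is what makes the candidates independent. *)
Lemma new_cells_disjoint b b' u : new_cells b u -> new_cells b' u -> b = b'.
Proof.
move=> /andP[bu _] /andP[_ /allP /(_ _ bu)]; rewrite inE (negPf (valP b)) orbF.
by move/eqP/val_inj.
Qed.

(** [position] embeds these cells into those over ['I_j.+1], which gives a bound independent of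
    [D]. *)
Lemma card_new_cells b : (#|new_cells b| <= #|cell 'I_j.+1|)%N.
Proof.
pose h (u : cell D) : cell 'I_j.+1 :=
  Tagged (fun S => (voc_arity S).-tuple 'I_j.+1) [tuple of map position (tagged
    u)].
pose g (v : cell 'I_j.+1) : cell D :=
  Tagged (fun S => (voc_arity S).-tuple D)
    [tuple of map (tnth [tuple of val b :: c]) (tagged v)].
apply: (@leq_card_in _ _ h); apply: (can_in_inj (g := g)).
move=> [S x] /andP[_ /allP all_x]; rewrite /g /h /=.
congr (Tagged _ _); apply: val_inj => /=; rewrite -map_comp.
by rewrite -[RHS]map_id; apply/eq_in_map => z /all_x; apply: positionK;
  exact: (valP b).
Qed.

Lemma prescribed_extension_realized (M : structure A tau D) b :
  pullback T (lift ord0) = pullback M (tnth c) ->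
  (forall u, new_cells b u -> M (tag u) (tagged u) = prescribed u) ->
  extension_realized M c T.
Proof.
move=> compat agree; apply/existsP; exists (val b); rewrite (valP b) /=.
apply/eqP/structureP => S x; rewrite pullbackE.
set y := [tuple of map _ x].
have yK : [tuple of map position y] = x.
  apply: val_inj; rewrite /= -map_comp -[RHS]map_id; apply: eq_map => i /=.
  by apply: tnthK_position; exact: (valP b).
(* An atomic fact that mentions the new point is a new cell, settled by [agree]; any other one comes
   from old indices, settled by [compat]. *)
have [x0|x0] := boolP (ord0 \in x).
  have := agree (Tagged (fun S => (voc_arity S).-tuple D) y).
  rewrite /prescribed /= yK; apply; apply/andP; split.
    by apply/mapP; exists ord0; rewrite ?tnth0.
  by apply/allP => _ /mapP[i _ ->]; exact: mem_tnth.
have [x' xE] : exists x' : (voc_arity S).-tuple 'I_j,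
    x = [tuple of map (lift ord0) x'].
  have lifted i : exists k, tnth x i = lift ord0 k.
    case: (unliftP ord0 (tnth x i)) => [k ->|e]; first by exists k.
    by case/negP: x0; rewrite -e mem_tnth.
  have [k kE] := choice lifted; exists [tuple k i | i < voc_arity S].
  by apply: eq_from_tnth => i; rewrite tnth_map tnth_mktuple kE.
have := congr1 (fun N : structure A tau 'I_j => N S x') compat.
rewrite !pullbackE -xE => ->; congr (M S _); apply: val_inj.
rewrite /= xE /= -map_comp; apply: eq_map => i /=.
by rewrite tnth_cons_lift.
Qed.

End OneExtension.

Variable delta : R.
Hypotheses (delta_gt0 : 0 < delta) (delta_le1 : delta <= 1).
Hypothesis delta_le : forall S a, delta <= p S a.

Lemma prob_extension_failure n j (c : j.-tuple 'I_n) T :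
  \sum_(M | ~~ extension_axiom M c T) prob p M <=
  (1 - delta ^+ #|cell 'I_j.+1|) ^+ (n - j).
Proof.
set q := delta ^+ _.
have q1 : q <= 1 by rewrite exprn_ile1 // ltW.
have [uc|/negPf uc] := boolP (uniq c); last first.
  rewrite big_pred0 ?exprn_ge0 ?subr_ge0 // => M.
  by rewrite /extension_axiom uc.
(* [G] is the indicator that each point outside [c] violates its prescription at some new cell. It
   equals 1 whenever the axiom fails, and it involves new cells only, so the diagram of [c] needs no
   conditioning. *)
pose G (M : structure A tau 'I_n) : R := \prod_(b : {b | b \notin c})
  (1 - \prod_(u | new_cells b u)
         (M (tag u) (tagged u) == prescribed c T u)%:R).
apply: (@le_trans _ _ (\sum_M prob p M * G M)).
  rewrite big_mkcond; apply: ler_sum => M _; case: ifP => [fails|_]; last first.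
    rewrite mulr_ge0 ?prob_ge0 // prodr_ge0 // => b _.
    by rewrite subr_ge0 prodr_ile1 // => u _; case: eqP => _;
      rewrite ?lexx ?ler01.
  rewrite /G big1 ?mulr1 // => b _; apply/eqP;
    rewrite subr_eq addrC -subr_eq subrr.
  move: fails; rewrite /extension_axiom uc implyTb negb_imply => /andP[/eqP
    compat nreal].
  have [u /andP[ub ne]] : exists u, new_cells b u &&
      (M (tag u) (tagged u) != prescribed c T u).
    apply/existsP; apply: contraNT nreal; rewrite negb_exists => /forallP agree.
    apply: (@prescribed_extension_realized _ _ _ _ uc M b) => // u ub.
    by have := agree u; rewrite ub /= negbK => /eqP.
  by rewrite (bigD1 u) //= (negPf ne) mul0r.
rewrite sum_structure /G.
under eq_bigr => F _ do under [X in _ * X]eq_bigr => b _ do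
  under eq_bigr => u _ do rewrite structure_of_cellsE.
rewrite (sum_ffun_disjoint_blocks (w := fun u : cell 'I_n => p (tag u))).
- have -> : (n - j)%N = #|{: {b | b \notin c}}|.
    have := cardC (mem c); rewrite card_ord (card_uniqP uc) size_tuple.
    move=> /(congr1 (subn^~ j)); rewrite addKn => <-.
    by rewrite card_sig; apply: eq_card => z; rewrite !inE.
  rewrite -prodr_const; apply: ler_prod => b _.
  have p01 u : 0 <= p (tag u) (prescribed c T u) <= 1.
    by have [/(_ (prescribed c T u))] := p_distr (tag u).
  rewrite subr_ge0 prodr_ile1 //= lerD2l lerN2.
  (* Each prescription holds with probability at least [delta] to the number of its cells, and
     [delta <= 1] allows the uniform exponent. *)
  apply: (@le_trans _ _ (delta ^+ #|new_cells b|)).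
    by rewrite ler_wiXn2l ?(ltW delta_gt0) ?card_new_cells.
  by rewrite -prodr_const; apply: ler_prod => u _; rewrite (ltW delta_gt0) /=.
- by move=> u; have [] := p_distr (tag u).
- by move=> b b' u; exact: new_cells_disjoint.
Qed.

(** Three nested union bounds: over [j], over the [n ^ j] tuples [c], and over the diagrams [T],
    whose number does not depend on [n]. *)
Lemma prob_not_saturated K n :
  \sum_(M : structure A tau 'I_n | ~~ saturated K M) prob p M <=
  \sum_(j < K) #|{: structure A tau 'I_j.+1}|%:R *
    (n%:R ^+ j * (1 - delta ^+ #|cell 'I_j.+1|) ^+ (n - j)).
Proof.
pose Q (j : 'I_K) (M : structure A tau 'I_n) :=
  [exists c : j.-tuple 'I_n, exists T, ~~ extension_axiom M c T].
apply: (le_trans (union_bound (@prob_ge0 n) (Q := Q) _)).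
  move=> M; rewrite negb_forall => /existsP[j]; rewrite negb_forall.
  move=> /existsP[c]; rewrite negb_forall => nT; exists j.
  by apply/existsP; exists c.
apply: ler_sum => j _.
pose Q' (c : j.-tuple 'I_n) (M : structure A tau 'I_n) :=
  [exists T, ~~ extension_axiom M c T].
apply: (le_trans (union_bound (@prob_ge0 n) (Q := Q') _)).
  by move=> M /existsP.
set e := _ ^+ (n - j); rewrite mulrA.
have -> : #|{: structure A tau 'I_j.+1}|%:R * n%:R ^+ j * e =
    \sum_(c : j.-tuple 'I_n) \sum_(T : structure A tau 'I_j.+1) e.
  by rewrite !sumr_const card_tuple card_ord -mulrnA -[RHS]mulr_natl natrM
    natrX.
apply: ler_sum => c _.
apply: (le_trans (union_bound (@prob_ge0 n)
  (Q := fun T M => ~~ extension_axiom M c T) _)); first by move=> M /existsP.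
by apply: ler_sum => T _; exact: prob_extension_failure.
Qed.

End RandomStructure.

(** * Almost sure saturation and the zero-one law *)

Section AlmostSureSaturation.
Variables (R : realType) (d : Order.disp_t) (A : finLatticeAlgebra d).
Variables (tau : finVocabulary) (p : tau -> A -> R).
Hypothesis p_distr : forall S : tau, is_distribution (p S).
Hypothesis p_gt0 : forall (S : tau) (a : A), 0 < p S a.

Lemma distribution_lower_bound :
  exists delta : R, [/\ 0 < delta, delta <= 1 & forall S a, delta <= p S a].
Proof.
have p01 S a : 0 <= p S a <= 1 by have [] := p_distr S.
(* With all factors in [[0, 1]], the product of all probabilities lies below each of them; it is
   also defined when [tau] has no symbols. *)
exists (\prod_S \prod_a p S a); split.
- by apply: prodr_gt0 => S _; apply: prodr_gt0 => a _.
- apply: prodr_ile1 => S _; rewrite prodr_ile1 // andbT.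
  by apply: prodr_ge0 => a _; rewrite ltW.
- move=> S a; rewrite (bigD1 S) //= (bigD1 a) //= -mulrA ler_piMr ?(ltW (p_gt0
    S a)) //.
  have prod01 S' (P : pred A) : 0 <= \prod_(a | P a) p S' a <= 1.
    by rewrite prodr_ile1 // prodr_ge0 // => ? _; rewrite ltW.
  have /andP[? ?] := prod01 S (predC1 a).
  apply: mulr_ile1 => //; first by apply: prodr_ge0 => S' _;
    have /andP[] := prod01 S' predT.
  by apply: prodr_ile1 => S' _; exact: prod01.
Qed.

Lemma cvg_prob_not_saturated K :
  \sum_(M : structure A tau 'I_n | ~~ saturated K M) prob p M @[n --> \oo]
    --> (0 : R).
Proof.
have [delta [delta0 delta1 delta_le]] := distribution_lower_bound.
apply: (@squeeze_cvgr _ _ _ _ (fun=> 0) (fun n => \sum_(j < K)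
    #|{: structure A tau 'I_j.+1}|%:R *
      (n%:R ^+ j * (1 - delta ^+ #|cell tau 'I_j.+1|) ^+ (n - j)))); last first.
- rewrite -[X in _ --> X](_ : \sum_(j < K) 0 = 0); last by rewrite big1.
  apply: cvg_big => [|j _]; first exact: add_continuous.
  rewrite -[X in _ --> X](mulr0 #|{: structure A tau 'I_j.+1}|%:R).
  apply: cvgMl_tmp; apply: cvg_polynomial_mul_expr_subn.
  by rewrite subr_ge0 ltrBlDr ltrDl exprn_gt0 // exprn_ile1 // ltW.
- exact: cvg_cst.
- apply: nearW => n; rewrite sumr_ge0 => [|M _]; last exact: prob_ge0.
  exact: prob_not_saturated.
Qed.

End AlmostSureSaturation.

Theorem theorem3p1 (R : realType) (d : Order.disp_t) (A : finLatticeAlgebra d)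
    (tau : finVocabulary) (p : tau -> A -> R)
    (p_distr : forall S : tau, is_distribution (p S))
    (p_gt0 : forall (S : tau) (a : A), 0 < p S a)
    (phi : sentence A tau) :
  (forall a : A, (mu p n phi a @[n --> \oo] --> (1 : R)) \/
                 (mu p n phi a @[n --> \oo] --> (0 : R))) /\
  (exists! a : A, mu p n phi a @[n --> \oo] --> (1 : R)).
Proof.
pose bad n := \sum_(M : structure A tau 'I_n | ~~ saturated (qrank phi) M) prob
  p M.
have bad0 : bad n @[n --> \oo] --> (0 : R) by exact: cvg_prob_not_saturated.
(* Once [bad n < 1], not every structure on [n] points can be unsaturated; any saturated one
   supplies the reference value [a0]. *)
have [n0 [M0 satM0]] : exists n, exists M : structure A tau 'I_n,
    saturated (qrank phi) M.
  have [n0 _ /(_ n0 (leqnn _)) bad1] := cvgr_lt _ bad0 _ ltr01.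
  exists n0; apply/existsP; apply: contraLR bad1; rewrite negb_exists.
  move=> /forallP unsat; rewrite -leNgt -(sum_prob p_distr n0).
  by rewrite /bad [leRHS](eq_bigl xpredT) // => M; rewrite unsat.
pose a0 := value M0 phi [tuple].
have sat_value n (M : structure A tau 'I_n) :
    saturated (qrank phi) M -> value M phi [tuple] = a0.
  by move=> satM; apply: saturated_value_sentence.
have pr0 := prob_ge0 p_distr.
have mu1 : mu p n phi a0 @[n --> \oo] --> (1 : R).
  (* Saturated structures all take the value [a0], and their total probability is [1 - bad n]. *)
  apply: (@squeeze_cvgr _ _ _ _ (fun n => 1 - bad n) (fun=> 1)).
  - apply: nearW => n; rewrite -(sum_prob p_distr n) /bad /mu.
    apply/andP; split; rewrite [X in _ <= X]big_mkcond /=; last first.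
      by rewrite big_mkcond; apply: ler_sum => M _; case: ifP.
    rewrite [X in X - _](bigID (fun M => saturated (qrank phi) M)) /= addrK.
    rewrite big_mkcond; apply: ler_sum => M _.
    by case: ifP => [/sat_value->|_]; rewrite ?eqxx //; case: ifP.
  - by rewrite -[X in _ --> X](subr0 (1 : R)); apply: cvgB => //;
      exact: cvg_cst.
  - exact: cvg_cst.
(* A value other than [a0] is taken only by unsaturated structures. *)
have mu0 a : a != a0 -> mu p n phi a @[n --> \oo] --> (0 : R).
  move=> aa0; apply: (@squeeze_cvgr _ _ _ _ (fun=> 0) bad) => //;
    last exact: cvg_cst.
  apply: nearW => n; rewrite sumr_ge0 //= /mu /bad.
  rewrite [leLHS]big_mkcond [leRHS]big_mkcond; apply: ler_sum => M _.
  case: ifPn => [/eqP va|_]; last by case: ifP.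
  by case: ifPn => // /negPn /sat_value; rewrite va => e; rewrite e eqxx in aa0.
split=> [a|].
  by have [->|/mu0] := eqVneq a a0; [left|right].
exists a0; split=> // a mua; apply/eqP; rewrite eq_sym;
  apply: contraT => /mu0 mua0.
have := oner_neq0 R.
by rewrite (cvg_unique (@Rhausdorff R) mua mua0) eqxx.
Qed.
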